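(* Let $r\geq 0$ be an integer and $k\in\{1,2,6,7,11,17\}$. Then for every integer $n\geq 0$, \[ p_{-(25r+k)}(25n+25-k)\equiv 0\pmod{25}. \]
   Context: For a positive integer $m$, $p_{-m}(n)$ denotes the number of $m$-colored partitions of $n$ (partitions in which each part may appear in $m$ colors), i.e. $\sum_{n\geq0}p_{-m}(n)q^n=\prod_{i\geq1}(1-q^i)^{-m}$. *)

(* Defs.v *)
From mathcomp Require Import all_boot.

Set Implicit Arguments.
Unset Strict Implicit.
Unset Printing Implicit Defensive.

(* An m-colored partition of n is encoded by its multiplicities: mu (i, c) is
   the number of parts of size i.+1 and color c.  In a partition of n, part
   sizes and multiplicities are at most n, so the index types 'I_n and 'I_n.+1
   lose nothing, and the encoding is one-to-one. *)
Definition colored_partitions (m n : nat) :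
    {set {ffun 'I_n * 'I_m -> 'I_n.+1}} :=
  [set mu : {ffun 'I_n * 'I_m -> 'I_n.+1} |
     \sum_(x : 'I_n * 'I_m) x.1.+1 * mu x == n].

(* The number p_{-m}(n), i.e. the coefficient of q^n in
   prod_{i >= 1} (1 - q^i)^{-m}. *)
Definition p_colored (m n : nat) : nat := #|colored_partitions m n|.

(* Main.v *)
(* Let E = prod (1 - q^i), G = 1/E, and let x, y, z be the parts of E carried by
   the exponents 0, 1, 2 mod 5; by the pentagonal number theorem (proved from
   Shanks' finite identity) E = x + y + z and y is q times a series in q^25.
   A sign-reversing reflection of pairs of pentagonal indices gives xz = -y^2.
   Hence D = E^5 - 5yE^4 + 15y^2E^3 = x^5 + 11y^5 + z^5 mod 25 is a series in
   q^5, and the part u_n of G^n carried by the exponents -n mod 5 satisfies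
   D u_(n+5) = u_n - 5y u_(n+1) + 15y^2 u_(n+2).  Iterating, u_11 = u_17 = 0 mod
   25, and for k = 1, 2, 6, 7 one gets u_k = 5c y^e / D^j with j = 1 or 2 and
   e = 5j - k.  Now E^25 = E(q^5)^5 mod 25 and D = E(q^5) mod 5, so the exponents
   -k mod 25 of 5 y^e E(q^5)^-(5r+j) come, up to a power of E(q^25), from the
   exponents -j mod 5 of E^(5-j), and those coefficients are divisible by 5. *)
From HB Require Import structures.
Require Import Defs.
From mathcomp Require Import all_boot all_algebra boolp zify ring.

Set Implicit Arguments.
Unset Strict Implicit.
Unset Printing Implicit Defensive.

Import GRing.Theory.
Local Open Scope ring_scope.

Definition series (R : Type) := nat -> R.

(** Functions on [nat] have no decidable equality, so the structures below the ring hierarchy are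
    taken from classical axioms. *)
HB.instance Definition _ (R : eqType) := gen_eqMixin (series R).
HB.instance Definition _ (R : choiceType) := gen_choiceMixin (series R).

(** * Formal power series *)

Section SeriesRing.
Variable R : comNzRingType.
Implicit Types (f g h : series R) (p q : {poly R}).

(** Polynomials approximating a series up to degree [n]: ring laws pass from [{poly R}] to series
    through truncations. *)
Definition agree n p f := forall i, (i <= n)%N -> p`_i = f i.

Definition trunc n f : {poly R} := \poly_(i < n.+1) f i.

Lemma agree_trunc n f : agree n (trunc n f) f.
Proof. by move=> i le_in; rewrite coef_poly ltnS le_in. Qed.

Definition addS f g : series R := fun n => f n + g n.
Definition oppS f : series R := fun n => - f n.
Definition mulS f g : series R := fun n => \sum_(i < n.+1) f i * g (n - i)%N.
Definition polyS p : series R := fun n => p`_n.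

Lemma agreeM n p q f g : agree n p f -> agree n q g -> agree n (p * q) (mulS f g).
Proof.
move=> pf qg i le_in; rewrite coefM; apply: eq_bigr => -[j /= lt_ji] _.
by rewrite pf ?qg //; lia.
Qed.

Lemma agree_eq f g :
  (forall n, exists2 p, agree n p f & agree n p g) -> f = g.
Proof. by move=> fg; apply/funext => n; have [p <- // <-] := fg n. Qed.

Lemma addSA : associative addS.
Proof. by move=> f g h; apply/funext => n; apply: addrA. Qed.
Lemma addSC : commutative addS.
Proof. by move=> f g; apply/funext => n; apply: addrC. Qed.
Lemma add0S : left_id (polyS 0) addS.
Proof. by move=> f; apply/funext => n; rewrite /addS /polyS coef0 add0r. Qed.
Lemma addNS : left_inverse (polyS 0) oppS addS.
Proof. by move=> f; apply/funext => n; rewrite /addS /polyS coef0 addNr. Qed.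

HB.instance Definition _ :=
  GRing.isZmodule.Build (series R) addSA addSC add0S addNS.

Lemma zeroSE n : (0 : series R) n = 0.
Proof. by rewrite -[RHS](coef0 R n). Qed.

Lemma mulSA : associative mulS.
Proof.
move=> f g h; apply: agree_eq => n.
have [F G H] := And3 (@agree_trunc n f) (@agree_trunc n g) (@agree_trunc n h).
exists (trunc n f * (trunc n g * trunc n h)); first by do !apply: agreeM.
by rewrite mulrA; do !apply: agreeM.
Qed.
Lemma mulSC : commutative mulS.
Proof.
move=> f g; apply: agree_eq => n; exists (trunc n f * trunc n g).
  by apply: agreeM; apply: agree_trunc.
by rewrite mulrC; apply: agreeM; apply: agree_trunc.
Qed.
Lemma mul1S : left_id (polyS 1) mulS.
Proof.
move=> f; apply: agree_eq => n; exists (trunc n f); last exact: agree_trunc.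
by rewrite -[trunc n f]mul1r; apply: agreeM => //; apply: agree_trunc.
Qed.
Lemma mulSDl : left_distributive mulS addS.
Proof.
move=> f g h; apply/funext => n; rewrite /mulS /addS -big_split /=.
by apply: eq_bigr => i _; rewrite mulrDl.
Qed.
Lemma oneS_neq0 : polyS 1 != 0.
Proof.
apply/eqP => /(congr1 (fun f : series R => f 0%N)).
by rewrite zeroSE /polyS coef1; apply/eqP/oner_neq0.
Qed.

HB.instance Definition _ :=
  GRing.Zmodule_isComNzRing.Build (series R) mulSA mulSC mul1S mulSDl oneS_neq0.

Lemma addSE f g n : (f + g) n = f n + g n. Proof. by []. Qed.
Lemma oppSE f n : (- f) n = - f n. Proof. by []. Qed.
Lemma oneSE n : (1 : series R) n = (n == 0%N)%:R.
Proof. by rewrite -coef1. Qed.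
Lemma mulSE f g n : (f * g) n = \sum_(i < n.+1) f i * g (n - i)%N.
Proof. by []. Qed.
Lemma mulnSE f m n : (f *+ m) n = f n *+ m.
Proof.
elim: m => [|m IH]; first by rewrite !mulr0n zeroSE.
by rewrite !mulrS addSE IH.
Qed.

Lemma polyS_zmod : zmod_morphism polyS.
Proof. by move=> p q; apply/funext => n; rewrite /polyS coefB. Qed.
Lemma polyS_monoid : monoid_morphism polyS.
Proof.
split=> // p q; apply: agree_eq => n; exists (p * q) => //.
exact: agreeM.
Qed.
HB.instance Definition _ :=
  GRing.isZmodMorphism.Build {poly R} (series R) polyS polyS_zmod.
HB.instance Definition _ :=
  GRing.isMonoidMorphism.Build {poly R} (series R) polyS polyS_monoid.

Definition eqS n f g := forall i, (i <= n)%N -> f i = g i.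

Lemma eqSM n f f' g g' : eqS n f f' -> eqS n g g' -> eqS n (f * g) (f' * g').
Proof.
move=> ff gg i le_in; rewrite !mulSE; apply: eq_bigr => -[j /= lt_ji] _.
by rewrite ff ?gg //; lia.
Qed.
Lemma eqSD n f f' g g' : eqS n f f' -> eqS n g g' -> eqS n (f + g) (f' + g').
Proof. by move=> ff gg i le_in; rewrite !addSE ff ?gg. Qed.
Lemma eqSX n m f g : eqS n f g -> eqS n (f ^+ m) (g ^+ m).
Proof.
by move=> fg; elim: m => [|m IH] //; rewrite !exprS; apply: eqSM.
Qed.
Lemma eqS_trans n g f h : eqS n f g -> eqS n g h -> eqS n f h.
Proof. by move=> fg gh i le_in; rewrite fg ?gh. Qed.
Lemma eqS_sym n f g : eqS n f g -> eqS n g f.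
Proof. by move=> fg i le_in; rewrite fg. Qed.

Lemma expS_low f : f 0%N = 0 -> forall m n, (n < m)%N -> (f ^+ m) n = 0.
Proof.
move=> f0; elim=> // m IH n lt_nm; rewrite exprS mulSE big_ord_recl f0 mul0r.
rewrite add0r big1 // => -[j /= lt_jn] _; rewrite IH ?mulr0 //.
by rewrite /bump /=; lia.
Qed.

(** The geometric series of [1 - f]. When [f 0 = 1], the power [(1 - f) ^+ i] starts at degree [i]
    or later, so the terms up to [n] settle the coefficient [n]. *)
Definition invS f : series R := fun n => (\sum_(i < n.+1) (1 - f) ^+ i) n.

Lemma mulSV f : f 0%N = 1 -> f * invS f = 1.
Proof.
move=> f0; apply/funext => n; set g := 1 - f.
have g0 : g 0%N = 0 by rewrite /g addSE oppSE f0 oneSE subrr.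
have inv_n : eqS n (invS f) (\sum_(i < n.+1) g ^+ i).
  move=> i; rewrite /invS -/g; elim: n => [|n IH].
    by rewrite leqn0 => /eqP->.
  rewrite leq_eqVlt => /predU1P[-> // | lt_in].
  by rewrite IH // [in RHS]big_ord_recr /= addSE (expS_low g0) ?addr0.
have -> : (f * invS f) n = (f * \sum_(i < n.+1) g ^+ i) n.
  by apply: (@eqSM n) => //.
have -> : f * \sum_(i < n.+1) g ^+ i = 1 - g ^+ n.+1.
  have -> : f = 1 - g by rewrite /g; ring.
  by rewrite -opprB mulNr -subrX1 opprB.
by rewrite addSE oppSE (expS_low g0) // subr0.
Qed.

Definition gr d i f : series R := fun n => if n == i %[mod d] then f n else 0.

Lemma grD d i f g : gr d i (f + g) = gr d i f + gr d i g.
Proof.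
by apply/funext => n; rewrite addSE /gr addSE; case: ifP; rewrite ?addr0.
Qed.
Lemma grN d i f : gr d i (- f) = - gr d i f.
Proof.
by apply/funext => n; rewrite oppSE /gr oppSE; case: ifP; rewrite ?oppr0.
Qed.
Lemma grMn d i f m : gr d i (f *+ m) = gr d i f *+ m.
Proof.
by apply/funext => n; rewrite mulnSE /gr; case: ifP => _; rewrite ?mulnSE ?mul0rn.
Qed.
Lemma gr_mod d i j f : (i = j %[mod d])%N -> gr d i f = gr d j f.
Proof. by move=> ij; rewrite /gr ij. Qed.

Lemma gr1 d : gr d 0 1 = 1.
Proof.
apply/funext => n; rewrite /gr oneSE.
by case: (altP (n =P 0%N)) => [->|]; rewrite ?eqxx //; case: ifP.
Qed.

Lemma gr_gr d i f : gr d i (gr d i f) = gr d i f.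
Proof. by apply/funext => n; rewrite /gr; case: ifP => // ->. Qed.

(** For the grading by exponents modulo [d], a factor homogeneous of degree [a] just shifts
    components. The dissections below are computed with this rule. *)
Lemma gr_mull d a i f g : gr d a f = f -> gr d (a + i) (f * g) = f * gr d i g.
Proof.
move=> fa; apply/funext => n; rewrite /gr !mulSE.
case: ifP => [/eqP|/eqP] n_ai; last first.
  rewrite big1 // => -[j /= lt_jn] _; rewrite -fa /gr.
  case: eqP => [ja|_]; last by rewrite mul0r.
  case: eqP => [jn|_]; last by rewrite mulr0.
  by case: n_ai; rewrite -(@subnKC j n) // -modnDm ja jn modnDm.
apply: eq_bigr => -[j /= lt_jn] _; rewrite -fa /gr.
case: eqP => [ja|_]; last by rewrite !mul0r.
case: eqP => // jn; case: jn; apply/eqP.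
by rewrite -(eqn_modDl j) subnKC // n_ai -modnDml -ja modnDml.
Qed.

(** The substitution q -> q^5. *)
Definition dil f : series R := fun n => if (5 %| n)%N then f (n %/ 5)%N else 0.

Lemma agree_dil n p f : agree n p f -> agree n (p \Po 'X^5) (dil f).
Proof.
move=> pf i le_in; rewrite coef_comp_poly_Xn // /dil; case: ifP => // _.
by apply: pf; apply: leq_trans le_in; apply: leq_div.
Qed.

Lemma dil_zmod : zmod_morphism dil.
Proof.
move=> f g; apply/funext => n; rewrite /dil !(addSE, oppSE) /dil.
by case: ifP; rewrite ?subr0.
Qed.
Lemma dil_monoid : monoid_morphism dil.
Proof.
split=> [|f g].
  apply/funext => n; rewrite /dil !oneSE; case: ifP => [/dvdnP[k ->]|].
    by rewrite mulnK // muln_eq0 orbF.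
  by case: n.
apply: agree_eq => n; have [F G] := (@agree_trunc n f, @agree_trunc n g).
exists ((trunc n f * trunc n g) \Po 'X^5); first exact/agree_dil/agreeM.
by rewrite rmorphM /=; apply: agreeM; apply: agree_dil.
Qed.
HB.instance Definition _ :=
  GRing.isZmodMorphism.Build (series R) (series R) dil dil_zmod.
HB.instance Definition _ :=
  GRing.isMonoidMorphism.Build (series R) (series R) dil dil_monoid.

Lemma gr_dil d i f : gr (5 * d) (5 * i) (dil f) = dil (gr d i f).
Proof.
apply/funext => n; rewrite /gr /dil; case: (boolP (5 %| n)%N); last by case: ifP.
by case/dvdnP=> k ->; rewrite mulnC mulKn // -!muln_modr eqn_pmul2l.
Qed.

End SeriesRing.

(** * The pentagonal number theorem *)

Section Pentagonal.
Variable R : comNzRingType.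

(* Both sides grow by the same amount from [n] to [n.+1], by a telescoping sum.
   At [q = 'X] the terms [s > 0] on the left have degree above [n]. *)
Lemma shanks (A : comNzRingType) (q : A) n :
  \sum_(s < n.+1) (-1) ^+ s * \prod_(s <= i < n) (1 - q ^+ i.+1) *
     q ^+ (s * n + 'C(s.+1, 2)) =
  1 + \sum_(m < n) (-1) ^+ m.+1 *
     (q ^+ (m.+1 ^ 2 + 'C(m.+1, 2)) + q ^+ (m.+1 ^ 2 + 'C(m.+2, 2))).
Proof.
elim: n => [|n IH].
  by rewrite big_ord1 big_ord0 big_geq //= !mul1r addr0.
rewrite [in RHS]big_ord_recr /= addrA -IH big_ord_recr /= [in LHS]big_geq //.
set a := fun s => (-1) ^+ s * \prod_(s <= i < n) (1 - q ^+ i.+1) *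
     q ^+ (s * n + 'C(s.+1, 2)).
pose b s := (1 - q ^+ s) * a s.
have ab s : (s < n)%N -> q ^+ (n.+1 + s) * a s = - b s.+1.
  move=> lt_sn; rewrite /b /a [in LHS]big_ltn //.
  have -> : (s.+1 * n + 'C(s.+2, 2) = n.+1 + s + (s * n + 'C(s.+1, 2)))%N.
    by rewrite [in LHS]binS bin1; lia.
  by rewrite (exprD q (n.+1 + s)) (exprS (-1)); ring.
have step s : (s < n.+1)%N -> (-1) ^+ s * \prod_(s <= i < n.+1) (1 - q ^+ i.+1) *
     q ^+ (s * n.+1 + 'C(s.+1, 2)) = a s - b s - q ^+ (n.+1 + s) * a s.
  move=> lt_sn; rewrite /b /a big_nat_recr //=.
  have -> : (s * n.+1 + 'C(s.+1, 2) = s + (s * n + 'C(s.+1, 2)))%N by lia.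
  rewrite !exprD; ring.
rewrite (eq_bigr (fun s : 'I_n.+1 => a s - b s - q ^+ (n.+1 + s) * a s)); last first.
  by move=> s _; apply: step.
rewrite [X in X + _]sumrB [X in X - _]sumrB.
rewrite [X in _ - X - _]big_ord_recr [X in _ - _ - X]big_ord_recr /=.
rewrite [X in _ - _ - (X + _)](eq_bigr (fun s : 'I_n => - b s.+1)); last first.
  by move=> s _; apply: ab.
rewrite sumrN.
have tele : \sum_(s < n) b s.+1 = \sum_(s < n) b s + b n.
  rewrite -(big_mkord xpredT b) -(big_mkord xpredT (fun s => b s.+1)).
  rewrite -[LHS](subrK (\sum_(0 <= s < n) b s)) -sumrB telescope_sumr //.
  by rewrite /b expr0 subrr mul0r subr0 addrC.
rewrite tele.
have -> : q ^+ (n.+1 + n) * a n = (-1) ^+ n * q ^+ (n.+1 ^ 2 + 'C(n.+1, 2)).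
  rewrite /a big_geq // mulr1 mulrCA -exprD; congr (_ * q ^+ _); lia.
have -> : (n.+1 * n.+1 = n.+1 ^ 2)%N by lia.
rewrite exprS; ring.
Qed.

Definition qprod n : {poly R} := \prod_(i < n) (1 - 'X^(i.+1)).

Lemma qprodE n k i : (i <= n)%N -> (qprod (n + k))`_i = (qprod n)`_i.
Proof.
move=> le_in; elim: k => [|k IH]; first by rewrite addn0.
rewrite addnS /qprod big_ord_recr /= -/(qprod _) mulrBr mulr1 coefB coefMXn.
by rewrite ifT ?subr0 //; lia.
Qed.

(** The infinite product read on the diagonal: by [qprodE], factors after the n-th leave the
    coefficient of q^n unchanged. *)
Definition euler : series R := fun n => (qprod n)`_n.

Lemma euler_qprod n : eqS n (polyS (qprod n)) euler.
Proof. by move=> i le_in; rewrite /euler -(subnKC le_in) /polyS qprodE. Qed.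

Lemma euler0 : euler 0%N = 1.
Proof. by rewrite /euler /qprod big_ord0 coef1. Qed.

(** Generalized pentagonal numbers. The product is even and nonnegative for every integer [z], so
    neither [absz] nor the division loses anything. *)
Definition pent (z : int) : nat := (absz (z * (3 * z - 1))%R %/ 2)%N.

Lemma pentE z : (2 * pent z)%:Z = z * (3 * z - 1).
Proof.
have [t zt] : exists t : int, z * (3 * z - 1) = 2 * t.
  have [q [zq|zq]] : exists q : int, z = 2 * q \/ z = 2 * q + 1.
  - by exists (z %/ 2)%Z; lia.
  - by exists (q * (6 * q - 1)); rewrite zq; ring.
  - by exists ((2 * q + 1) * (3 * q + 1)); rewrite zq; ring.
have : 0 <= z * (3 * z - 1) by nia.
by rewrite /pent zt; lia.
Qed.

Lemma pent_inj a z : (2 * a)%:Z = z * (3 * z - 1) -> pent z = a.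
Proof. by move=> az; have := pentE z; lia. Qed.

Definition idx n (i : 'I_n.*2.+1) : int := i%:Z - n%:Z.

Definition eterm (z : int) : {poly R} := (-1) ^+ `|z|%N * 'X^(pent z).

Definition theta n : {poly R} := \sum_i eterm (@idx n i).

(** The indices m+1 and -(m+1) pair up: their pentagonal numbers are (m+1)^2 + C(m+1,2) and (m+1)^2
    + C(m+2,2). *)
Lemma thetaE n :
  theta n = 1 + \sum_(m < n) (-1) ^+ m.+1 *
     ('X^(m.+1 ^ 2 + 'C(m.+1, 2)) + 'X^(m.+1 ^ 2 + 'C(m.+2, 2))).
Proof.
elim: n => [|n IH].
  by rewrite big_ord0 /theta big_ord1 /eterm /idx /= subrr /= mul1r addr0.
rewrite [in RHS]big_ord_recr /= addrA -IH /theta big_ord_recl big_ord_recr /=.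
have bin2E m : (2 * 'C(m.+1, 2) = m * m.+1)%N.
  by elim: m => // m IHm; rewrite binS bin1; lia.
have idx_in (i : 'I_n.*2.+1) :
    idx (lift ord0 (widen_ord (leqnSn _) i) : 'I_n.+1.*2.+1) = idx i.
  by rewrite /idx lift0 /=; lia.
have -> : eterm (@idx n.+1 ord0) = (-1) ^+ n.+1 * 'X^(n.+1 ^ 2 + 'C(n.+2, 2)).
  have -> : @idx n.+1 ord0 = - n.+1%:Z by rewrite /idx sub0r.
  rewrite /eterm abszN; congr (_ * 'X^_).
  by apply: pent_inj; have := bin2E n.+1; lia.
have -> : eterm (@idx n.+1 (lift ord0 ord_max)) =
    (-1) ^+ n.+1 * 'X^(n.+1 ^ 2 + 'C(n.+1, 2)).
  have -> : @idx n.+1 (lift ord0 ord_max) = n.+1%:Z.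
    by rewrite /idx lift0 -[nat_of_ord ord_max]/(n.*2.+1); lia.
  rewrite /eterm; congr (_ * 'X^_).
  by apply: pent_inj; have := bin2E n; lia.
rewrite mulrDr [X in _ + X = _]addrC [RHS]addrC [X in _ = X + _]addrC -addrA.
by congr (_ + (_ + _)); apply: eq_bigr => i _; rewrite -idx_in.
Qed.

Lemma euler_theta n : eqS n (polyS (theta n)) euler.
Proof.
apply: eqS_trans (@euler_qprod n) => i le_in; rewrite /polyS thetaE.
have /(congr1 (fun p : {poly R} => p`_i)) /= <- := @shanks _ ('X : {poly R}) n.
rewrite big_ord_recl /= mul1r mul0n add0n mulr1 big_mkord coefD coef_sum.
rewrite [X in _ + X]big1 ?addr0 // => -[j lt_jn] _.
by rewrite coefMXn ifT // /bump /= binS bin1; nia.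
Qed.

End Pentagonal.

(** * The 5-dissection of the Euler product *)

Section Dissection.
Variable R : comNzRingType.
Hypothesis two_reg : forall a : R, a + a = 0 -> a = 0.

Local Notation E := (euler R).

Lemma coef_eterm z i :
  (eterm R z)`_i = if i == pent z then (-1) ^+ `|z|%N else 0.
Proof.
rewrite /eterm -(signr_odd {poly R}) -(signr_odd R) mulr_sign.
by case: odd; rewrite ?coefN coefXn; case: eqP => // _; rewrite oppr0.
Qed.

Lemma euler_coef n i : (i <= n)%N ->
  E i = \sum_(j < n.*2.+1) if i == pent (idx j) then (-1) ^+ `|idx j|%N else 0.
Proof.
move=> le_in; rewrite -(euler_theta R le_in) /polyS coef_sum.
by apply: eq_bigr => j _; rewrite coef_eterm.
Qed.

Lemma modz5_cases (z : int) : (z %% 5)%Z \in [:: 0; 1; 2; 3; 4].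
Proof. by rewrite !inE; lia. Qed.

(** Table of pentagonal residues modulo 5 by index class; the residues 3 and 4 never occur. *)
Definition pent5 (c : int) : nat :=
  if c == 1 then 1%N else if (c == 3) || (c == 4) then 2%N else 0%N.

Lemma pent_mod5 z : (pent z %% 5 = pent5 (z %% 5)%Z)%N.
Proof.
have := pentE z; rewrite {2 3}(divz_eq z 5); move: (z %/ 5)%Z (modz5_cases z) => w.
have -> c : (w * 5 + c) * (3 * (w * 5 + c) - 1) =
    5 * (15 * w ^+ 2 + (6 * c - 1) * w) + c * (3 * c - 1) by ring.
move: (z %% 5)%Z => c; move: (_ + (6 * c - 1) * w) => t.
by rewrite !inE /pent5 => /or4P[|||/orP[]] /eqP-> /=; lia.
Qed.

(** Residue 1 forces z = 5w + 1, and then [pent z] is 1 + 25 w(3w+1)/2; the parity split on w makes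
    the half an integer. *)
Lemma pent_mod25 z : (pent z = 1 %[mod 5] -> pent z = 1 %[mod 25])%N.
Proof.
move=> p1; have z1 : (z %% 5)%Z = 1.
  by move: p1; rewrite pent_mod5 /pent5; do ?case: eqP.
have := pentE z; have -> : z = 5 * (z %/ 5)%Z + 1 by lia.
move: (z %/ 5)%Z => w pE; have [q [wq|wq]] : exists q : int, w = 2 * q \/ w = 2 * q + 1.
- by exists (w %/ 2)%Z; lia.
- have e : (5 * w + 1) * (3 * (5 * w + 1) - 1) = 2 * (25 * (q * (6 * q + 1)) + 1).
    by rewrite wq; ring.
  by move: pE; rewrite e; move: (q * _) => t; lia.
- have e : (5 * w + 1) * (3 * (5 * w + 1) - 1) =
    2 * (25 * ((2 * q + 1) * (3 * q + 2)) + 1) by rewrite wq; ring.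
  by move: pE; rewrite e; move: (_ * (3 * q + 2)) => t; lia.
Qed.

Lemma gr_euler_eq0 i : (i == 3) || (i == 4) -> gr 5 i E = 0.
Proof.
move=> i34; apply/funext => n; rewrite zeroSE /gr; case: eqP => // n_i.
rewrite (euler_coef (leqnn n)) big1 // => j _; case: eqP => // n_pent.
have := pent_mod5 (idx j); rewrite -n_pent n_i.
by case/orP: i34 => /eqP ->; rewrite /pent5; do ?case: ifP.
Qed.

Lemma gr_euler1 : gr 25 1 (gr 5 1 E) = gr 5 1 E.
Proof.
apply/funext => n; rewrite /gr; case: eqP => // n25; case: eqP => // n5.
rewrite (euler_coef (leqnn n)) big1 // => j _; case: eqP => // n_pent.
by case: n25; rewrite n_pent; apply: pent_mod25; rewrite -n_pent.
Qed.

Lemma euler_split : E = gr 5 0 E + gr 5 1 E + gr 5 2 E.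
Proof.
suff {1}-> : E = gr 5 0 E + gr 5 1 E + gr 5 2 E + gr 5 3 E + gr 5 4 E.
  by rewrite (gr_euler_eq0 (i := 3)) // (gr_euler_eq0 (i := 4)) // !addr0.
apply/funext => n; rewrite !addSE /gr.
have : (n %% 5 < 5)%N by rewrite ltn_mod.
by case: (n %% 5)%N => [|[|[|[|[|]]]]] //= _; rewrite ?addr0 ?add0r.
Qed.

(** Splitting by index class refines splitting by exponent: exponents 0 mod 5 come from the classes
    0 and 2, exponents 2 mod 5 from 3 and 4. *)
Definition tpart n (c : int) : {poly R} :=
  \sum_(j < n.*2.+1) if (idx j %% 5)%Z == c then eterm R (idx j) else 0.

Lemma gr_theta n i : eqS n (gr 5 i E)
  (polyS (\sum_(j < n.*2.+1)
     if pent (idx j) == i %[mod 5] then eterm R (idx j) else 0)).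
Proof.
move=> k le_kn; rewrite /polyS coef_sum /gr (euler_coef le_kn).
case: eqP => ki; last first.
  rewrite big1 // => j _; rewrite (fun_if (fun p : {poly R} => p`_k)) coef_eterm coef0.
  by case: (k =P _) => [kp|_]; rewrite ?if_same // -kp; case: eqP.
apply: eq_bigr => j _; rewrite (fun_if (fun p : {poly R} => p`_k)) coef_eterm coef0.
by case: (k =P _) => [<-|_]; rewrite ?if_same // ki eqxx.
Qed.

(* [(flip1, flip2)] is the reflection ((3z-4w+1)/5, (2-4z-3w)/5); in the variables
   6z-1, 6w-1 it is linear and orthogonal, so it preserves pent z + pent w, and
   it reverses the parity of z + w. *)
Definition flip1 (z w : int) : int := ((3 * z - 4 * w + 1) %/ 5)%Z.
Definition flip2 (z w : int) : int := ((2 - 4 * z - 3 * w) %/ 5)%Z.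

(** This single congruence makes both divisions by 5 in the reflection exact. *)
Definition flippable (z w : int) : bool := ((w - 2 * z + 1) %% 5)%Z == 0.

Lemma flipE z w : flippable z w ->
  5 * flip1 z w = 3 * z - 4 * w + 1 /\ 5 * flip2 z w = 2 - 4 * z - 3 * w.
Proof. by rewrite /flippable /flip1 /flip2 => /eqP; lia. Qed.

Lemma flip_flippable z w : flippable z w -> flippable (flip1 z w) (flip2 z w).
Proof. by move/flipE; rewrite /flippable => -[? ?]; apply/eqP; lia. Qed.

Lemma flipK z w : flippable z w ->
  flip1 (flip1 z w) (flip2 z w) = z /\ flip2 (flip1 z w) (flip2 z w) = w.
Proof.
by move=> zw; have [? ?] := flipE zw; have [? ?] := flipE (flip_flippable zw); lia.
Qed.

Lemma pent_flip z w : flippable z w ->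
  (pent (flip1 z w) + pent (flip2 z w) = pent z + pent w)%N.
Proof.
move=> zw; have [e1 e2] := flipE zw.
have [p1 p2 p3 p4] := And4 (pentE z) (pentE w) (pentE (flip1 z w)) (pentE (flip2 z w)).
set a := flip1 z w in e1 p3 *; set b := flip2 z w in e2 p4 *.
have e : 25 * (a * (3 * a - 1) + b * (3 * b - 1))
       = 25 * (z * (3 * z - 1) + w * (3 * w - 1)).
  have -> : 25 * (a * (3 * a - 1) + b * (3 * b - 1))
    = 3 * (5 * a) ^+ 2 - 5 * (5 * a) + 3 * (5 * b) ^+ 2 - 5 * (5 * b) by ring.
  by rewrite e1 e2; ring.
lia.
Qed.

Lemma odd_flip z w : flippable z w ->
  odd (`|flip1 z w| + `|flip2 z w|) = ~~ odd (`|z| + `|w|).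
Proof. by move=> zw; have [e1 e2] := flipE zw; lia. Qed.

(** Keeps the reflected indices in the window from -n to n when the two exponents add up to n. *)
Lemma abs_le_pent z : (`|z| <= pent z)%N.
Proof. by have := pentE z; nia. Qed.


Definition ord_of n (z : int) : 'I_n.*2.+1 := inord (absz (z + n%:Z)).

Lemma ord_ofK n z : (`|z| <= n)%N -> idx (ord_of n z) = z.
Proof. by move=> zn; rewrite /idx /ord_of inordK; lia. Qed.

Lemma idxK n (i : 'I_n.*2.+1) : ord_of n (idx i) = i.
Proof. by rewrite /ord_of /idx subrK; apply: inord_val. Qed.

Lemma flip_sum n :
  \sum_(p : 'I_n.*2.+1 * 'I_n.*2.+1 | flippable (idx p.1) (idx p.2) &&
      (pent (idx p.1) + pent (idx p.2) == n)%N)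
    (-1) ^+ (`|idx p.1| + `|idx p.2|) = 0 :> R.
Proof.
pose P (p : 'I_n.*2.+1 * 'I_n.*2.+1) := flippable (idx p.1) (idx p.2) &&
  (pent (idx p.1) + pent (idx p.2) == n)%N.
(* The identity outside [P] turns the reflection into an involution of the whole index type, as
   reindexing requires. *)
pose h p := if P p then (ord_of n (flip1 (idx p.1) (idx p.2)),
                         ord_of n (flip2 (idx p.1) (idx p.2))) else p.
have idx_h p : P p -> idx (h p).1 = flip1 (idx p.1) (idx p.2) /\
                      idx (h p).2 = flip2 (idx p.1) (idx p.2).
  move=> Pp; rewrite /h Pp /=; case/andP: Pp => fp /eqP pn.
  have := pent_flip fp; have := abs_le_pent (flip1 (idx p.1) (idx p.2)).
  have := abs_le_pent (flip2 (idx p.1) (idx p.2)) => *.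
  by split; apply: ord_ofK; lia.
have P_h p : P (h p) = P p.
  case Pp: (P p); last by rewrite /h Pp.
  have [h1 h2] := idx_h _ Pp; case/andP: Pp => fp pn.
  by rewrite /P h1 h2 flip_flippable // pent_flip.
have hK : involutive h.
  move=> p; case Pp: (P p); last by rewrite /h Pp Pp.
  have [h1 h2] := idx_h _ Pp.
  rewrite {1}/h P_h Pp h1 h2; case/andP: Pp => fp _.
  by have [-> ->] := flipK fp; rewrite !idxK; case: (p).
(* Reindexing along [h] reverses every sign, so the sum is its own opposite. *)
apply: two_reg; apply/eqP; rewrite addr_eq0 -sumrN; apply/eqP.
rewrite (reindex_inj (inv_inj hK)) (eq_bigl P) //=; apply: eq_bigr => p Pp.
have [-> ->] := idx_h _ Pp; case/andP: Pp => fp _.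
by rewrite -signr_odd odd_flip // signrN signr_odd.
Qed.

(** The solutions of w = 2z - 1 modulo 5. Up to order, the first four run once through {0,2} x
    {3,4}, the classes making up the product of the components 0 and 2 of [E]; the last gives the
    square of the component 1. *)
Lemma class_split (z w : int) :
  let c k := (z %% 5)%Z == k in let d k := (w %% 5)%Z == k in
  (flippable z w : nat) = ((c 0 && d 4) + (c 2 && d 3) + (c 3 && d 0) + (c 4 && d 2)
    + (c 1 && d 1))%N.
Proof.
move=> c d; rewrite /c /d; have -> : flippable z w =
    (((w %% 5)%Z - 2 * (z %% 5)%Z + 1) %% 5 == 0)%Z by rewrite /flippable; lia.
move: (modz5_cases z) (modz5_cases w); rewrite !inE.
by do 2![case/or4P=> [|||/orP[]] /eqP->].
Qed.

Lemma tpartM n c d : tpart n c * tpart n d =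
  \sum_(p : 'I_n.*2.+1 * 'I_n.*2.+1)
    (eterm R (idx p.1) * eterm R (idx p.2))
      *+ (((idx p.1 %% 5)%Z == c) && ((idx p.2 %% 5)%Z == d)).
Proof.
rewrite /tpart big_distrlr pair_bigA; apply: eq_bigr => -[i j] _ /=.
by case: eqP; case: eqP; rewrite ?mulr0 ?mul0r.
Qed.

Lemma tpart_sum n : (tpart n 0 * tpart n 4 + tpart n 2 * tpart n 3 +
  tpart n 3 * tpart n 0 + tpart n 4 * tpart n 2 + tpart n 1 * tpart n 1)`_n = 0.
Proof.
rewrite !tpartM -!big_split coef_sum /= -[RHS](flip_sum n) [RHS]big_mkcond.
apply: eq_bigr => -[i j] _ /=; rewrite -!mulrnDr -class_split.
rewrite /eterm mulrACA -!exprD -(signr_odd {poly R}) mulr_sign coefMn.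
case: flippable => //=; rewrite mulr1n eq_sym -(signr_odd R).
by case: odd; rewrite ?coefN coefXn; case: eqP; rewrite ?oppr0.
Qed.

Lemma gr_theta_eqS n i (c : seq int) :
  (forall z, ((pent z == i %[mod 5])%N : nat) = (\sum_(k <- c) ((z %% 5)%Z == k))%N) ->
  eqS n (gr 5 i E) (polyS (\sum_(k <- c) tpart n k)).
Proof.
move=> class_c; have := @gr_theta n i; congr (eqS _ _ (polyS _)).
rewrite /tpart exchange_big /=; apply: eq_bigr => j _.
under [RHS]eq_bigr => k _ do rewrite -mulrb.
by rewrite sumrMnr -class_c mulrb.
Qed.

Lemma euler_dissect : gr 5 0 E * gr 5 2 E = - gr 5 1 E ^+ 2.
Proof.
apply/eqP; rewrite -addr_eq0; apply/eqP/funext => n; rewrite zeroSE.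
have g0 : eqS n (gr 5 0 E) (polyS (tpart n 0 + tpart n 2)).
  have := @gr_theta_eqS n 0 [:: 0; 2]; rewrite !big_cons big_nil addr0; apply => z.
  rewrite !big_cons big_nil pent_mod5; move: (modz5_cases z).
  by rewrite !inE => /or4P[|||/orP[]] /eqP->.
have g1 : eqS n (gr 5 1 E) (polyS (tpart n 1)).
  have := @gr_theta_eqS n 1 [:: 1]; rewrite !big_cons big_nil addr0; apply => z.
  rewrite !big_cons big_nil pent_mod5; move: (modz5_cases z).
  by rewrite !inE => /or4P[|||/orP[]] /eqP->.
have g2 : eqS n (gr 5 2 E) (polyS (tpart n 3 + tpart n 4)).
  have := @gr_theta_eqS n 2 [:: 3; 4]; rewrite !big_cons big_nil addr0; apply => z.
  rewrite !big_cons big_nil pent_mod5; move: (modz5_cases z).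
  by rewrite !inE => /or4P[|||/orP[]] /eqP->.
rewrite (eqSD (eqSM g0 g2) (eqSX 2 g1) (leqnn n)) -!(rmorphM, rmorphD, rmorphXn) /=.
rewrite /polyS -[RHS](tpart_sum n); congr (nth 0 (polyseq _) n); ring.
Qed.

End Dissection.

(** * Colored partitions *)

Section Colored.
Variable R : comNzRingType.

Lemma euler_inv : euler R * invS (euler R) = 1.
Proof. exact/mulSV/euler0. Qed.

(** Geometric factors are cut after multiplicity [n], so the terms of the expanded product are
    indexed by the same functions [mu] as in [colored_partitions]. *)
Definition cpoly m n : {poly R} :=
  \prod_(x : 'I_n * 'I_m) \sum_(j < n.+1) ('X^(x.1.+1)) ^+ j.

Lemma coef_cpoly m n : (cpoly m n)`_n = (p_colored m n)%:R.
Proof.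
rewrite /cpoly bigA_distr_bigA coef_sum /p_colored -sum1_card natr_sum.
rewrite [RHS]big_mkcond; apply: eq_bigr => mu _ /=.
under eq_bigr => x _ do rewrite -exprM.
by rewrite prodrXr coefXn inE eq_sym; case: eqP.
Qed.

(** Each truncated geometric sum telescopes; all exponents left on the right exceed [n]. *)
Lemma cpolyM m n : cpoly m n * qprod R n ^+ m =
  \prod_(x : 'I_n * 'I_m) (1 - ('X^(x.1.+1)) ^+ n.+1).
Proof.
have -> : qprod R n ^+ m = \prod_(x : 'I_n * 'I_m) (1 - 'X^(x.1.+1)).
  rewrite -(pair_bigA _ (fun (i : 'I_n) (c : 'I_m) => 1 - 'X^(i.+1) : {poly R})) /=.
  under [RHS]eq_bigr => i _ do rewrite prodr_const card_ord.
  by rewrite prodrXl.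
rewrite -big_split; apply: eq_bigr => x _ /=.
by rewrite -[RHS]opprB subrX1 -mulNr opprB mulrC.
Qed.

Lemma eqS_prod1 (I : finType) (F : I -> series R) n :
  (forall i, eqS n (F i) 1) -> eqS n (\prod_i F i) 1.
Proof.
move=> F1; elim/big_rec: _ => [|i f _ f1] //.
by rewrite -[X in eqS n _ X]mulr1; apply: eqSM.
Qed.

Lemma colored_series m n : (invS (euler R) ^+ m) n = (p_colored m n)%:R.
Proof.
rewrite -coef_cpoly; set G := invS _.
have QE : eqS n (polyS (cpoly m n) * euler R ^+ m) 1.
  apply: eqS_trans (eqSM (fun i _ => erefl) (eqSX m (eqS_sym (@euler_qprod R n)))) _.
  rewrite -rmorphXn -rmorphM cpolyM /= rmorph_prod; apply: eqS_prod1 => x i le_in.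
  rewrite rmorphB rmorph1 addSE oppSE /= /polyS -exprM coefXn.
  by rewrite ltn_eqF ?subr0 //; nia.
rewrite -[RHS]/(polyS (cpoly m n) n) -[G ^+ m]mul1r.
rewrite -(eqSM QE (fun i _ => erefl) (leqnn n)) -mulrA -exprMn euler_inv.
by rewrite expr1n mulr1.
Qed.

End Colored.

(** * Frobenius congruences modulo 5 and 25 *)

Section Frobenius.
Variable A : comNzRingType.
Hypothesis char25 : 25%:R = 0 :> A.

Lemma mul25 (a : A) : a *+ 25 = 0.
Proof. by rewrite -mulr_natr char25 mulr0. Qed.

(** Where 25 = 0, a congruence modulo 5 is written as an equality after multiplication by 5. *)
Lemma frob5 (a : A) : (1 - a) ^+ 5 *+ 5 = (1 - a ^+ 5) *+ 5.
Proof.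
apply/eqP; rewrite -subr_eq0; apply/eqP.
by rewrite -[RHS](mul25 (a ^+ 4 - a ^+ 3 *+ 2 + a ^+ 2 *+ 2 - a)); ring.
Qed.

(** With (1 - a)^5 = b + 5g, every term of (b + 5g)^5 other than b^5 is divisible by 25. *)
Lemma frob25 (a : A) : (1 - a) ^+ 25 = (1 - a ^+ 5) ^+ 5.
Proof.
pose b := 1 - a ^+ 5; pose g := a ^+ 4 - a ^+ 3 *+ 2 + a ^+ 2 *+ 2 - a.
have -> : (1 - a) ^+ 25 = ((1 - a) ^+ 5) ^+ 5 by rewrite -exprM.
have -> : (1 - a) ^+ 5 = b + g *+ 5 by rewrite /b /g; ring.
rewrite -/b -[RHS]addr0 -(mul25 (b ^+ 4 * g + b ^+ 3 * g ^+ 2 *+ 10 +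
  b ^+ 2 * g ^+ 3 *+ 50 + b * g ^+ 4 *+ 125 + g ^+ 5 *+ 125)).
by move: b g => b g; ring.
Qed.

Lemma eq5X (a b : A) m : a *+ 5 = b *+ 5 -> a ^+ m *+ 5 = b ^+ m *+ 5.
Proof.
move=> ab; elim: m => // m IH.
by rewrite !exprS -mulrnAl ab mulrnAl -mulrnAr IH mulrnAr.
Qed.

End Frobenius.

(** * Congruences modulo 25 *)

Section Congruences.
Variable R : comNzRingType.
Hypothesis char25 : 25%:R = 0 :> R.

Local Notation E := (euler R).
Local Notation G := (invS (euler R)).
Local Notation x := (gr 5 0 E).
Local Notation y := (gr 5 1 E).
Local Notation z := (gr 5 2 E).

Lemma char25_series : 25%:R = 0 :> series R.
Proof. by apply/funext => n; rewrite mulnSE zeroSE -mulr_natr char25 mulr0. Qed.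

Lemma char25_poly : 25%:R = 0 :> {poly R}.
Proof. by rewrite -polyC_natr char25. Qed.

Lemma two_reg (a : R) : a + a = 0 -> a = 0.
Proof.
(* 13 inverts 2 modulo 25. *)
move=> a2; have -> : a = (a + a) *+ 13 - a *+ 25 by ring.
by rewrite a2 mul0rn (mul25 char25) subr0.
Qed.

Lemma xz : x * z = - y ^+ 2. Proof. exact/euler_dissect/two_reg. Qed.

Lemma dil_qprod n : qprod R n \Po 'X^5 = \prod_(i < n) (1 - 'X^(i.+1) ^+ 5).
Proof.
rewrite rmorph_prod; apply: eq_bigr => i _ /=.
by rewrite rmorphB rmorph1 rmorphXn /= comp_polyX exprAC.
Qed.

Lemma eqS_dil_qprod n : eqS n (polyS (qprod R n \Po 'X^5)) (dil E).
Proof. by apply: agree_dil => i le_in; apply: euler_qprod. Qed.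

Lemma euler5 : E ^+ 5 *+ 5 = dil E *+ 5.
Proof.
apply/funext => n.
have e5 : qprod R n ^+ 5 *+ 5 = (qprod R n \Po 'X^5) *+ 5.
  rewrite dil_qprod /qprod -prodrXl; elim/big_ind2: _ => // [a b c d ab cd|i _].
    by rewrite -mulrnAl ab mulrnAl -mulrnAr cd mulrnAr.
  exact: frob5 char25_poly _.
transitivity (polyS (qprod R n ^+ 5 *+ 5) n).
  by rewrite rmorphMn rmorphXn !mulnSE (eqSX 5 (@euler_qprod R n) (leqnn n)).
by rewrite e5 rmorphMn !mulnSE /= (eqS_dil_qprod (leqnn n)).
Qed.

Lemma euler25 : E ^+ 25 = dil E ^+ 5.
Proof.
apply/funext => n; rewrite -(eqSX 25 (@euler_qprod R n) (leqnn n)).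
rewrite -(eqSX 5 (@eqS_dil_qprod n) (leqnn n)).
transitivity (polyS (qprod R n ^+ 25) n); first by rewrite rmorphXn.
transitivity (polyS ((qprod R n \Po 'X^5) ^+ 5) n); last by rewrite rmorphXn.
rewrite dil_qprod -!prodrXl; congr (polyS _ n); apply: eq_bigr => i _.
exact: frob25 char25_poly _.
Qed.

Lemma gr_y i f : gr 5 i.+1 (y * f) = y * gr 5 i f.
Proof. by rewrite -[i.+1]add1n gr_mull ?gr_gr. Qed.

Lemma gr_y2 i f : gr 5 i.+2 (y ^+ 2 * f) = y ^+ 2 * gr 5 i f.
Proof. by rewrite expr2 -!mulrA !gr_y. Qed.

(** [E] has only the components x, y, z of degrees 0, 1, 2. Iterating these formulas gives the
    components of the powers of [E]. *)
Lemma gr_euler_mul f : [/\ gr 5 0 (E * f) = x * gr 5 0 f + y * gr 5 4 f + z * gr 5 3 f,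
  gr 5 1 (E * f) = x * gr 5 1 f + y * gr 5 0 f + z * gr 5 4 f,
  gr 5 2 (E * f) = x * gr 5 2 f + y * gr 5 1 f + z * gr 5 0 f,
  gr 5 3 (E * f) = x * gr 5 3 f + y * gr 5 2 f + z * gr 5 1 f &
  gr 5 4 (E * f) = x * gr 5 4 f + y * gr 5 3 f + z * gr 5 2 f].
Proof.
have grE i j k : (i = j.+1 %[mod 5])%N -> (i = k.+2 %[mod 5])%N ->
    gr 5 i (E * f) = x * gr 5 i f + y * gr 5 j f + z * gr 5 k f.
  move=> ij ik; rewrite {1}euler_split !mulrDl !grD.
  rewrite -{1}[i]add0n gr_mull ?gr_gr // (gr_mod (y * f) ij) gr_y.
  by rewrite (gr_mod (z * f) ik) -[k.+2]add2n gr_mull ?gr_gr.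
by split; apply: grE.
Qed.

(** For k = 2, 3, 4, a monomial of degree k in x, y, z with exponents k mod 5 contains x and z
    equally often, so [xz] turns the component into a multiple of y^k. The factor 5 arising for k =
    3, 4 supplies the final divisibility. *)
Lemma gr_euler2 : gr 5 2 (E ^+ 2) = - y ^+ 2.
Proof.
have [_ _ -> _ _] := gr_euler_mul E.
by ring: xz.
Qed.

Lemma gr_euler3 : gr 5 3 (E ^+ 3) = - y ^+ 3 *+ 5.
Proof.
have [_ _ _ -> _] := gr_euler_mul (E ^+ 2).
have [_ -> -> -> _] := gr_euler_mul E.
rewrite !(@gr_euler_eq0 R 3) // !(@gr_euler_eq0 R 4) //.
by ring: xz.
Qed.

Lemma gr_euler4 : gr 5 4 (E ^+ 4) = - y ^+ 4 *+ 5.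
Proof.
have [_ _ _ _ ->] := gr_euler_mul (E ^+ 3).
have [_ _ -> -> ->] := gr_euler_mul (E ^+ 2).
have [-> -> -> -> ->] := gr_euler_mul E.
rewrite !(@gr_euler_eq0 R 3) // !(@gr_euler_eq0 R 4) //.
by ring: xz.
Qed.

(* With t = -E/y this is -y^5 (t^5 + 5t^4 + 15t^3 + 25t^2 + 25t) modulo 25, the
   level 5 modular equation for eta(z)/eta(25z). *)
Definition disc : series R := E ^+ 5 - (y * E ^+ 4) *+ 5 + (y ^+ 2 * E ^+ 3) *+ 15.
Local Notation D := disc.
Local Notation W := (invS disc).

Lemma discE : D = x ^+ 5 + y ^+ 5 *+ 11 + z ^+ 5.
Proof.
have e : E = x + y + z by exact: euler_split.
rewrite /disc; move: E x y z e xz => e a b c -> ac.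
rewrite -[LHS]subr0.
(* Restores the terms 25t^2 and 25t of the modular equation; the identity is then exact given xz =
   -y^2. *)
rewrite -(mul25 char25_series (b ^+ 3 * (a + b + c) ^+ 2 - b ^+ 4 * (a + b + c))).
by ring: ac.
Qed.

Lemma gr_expr5 i (f : series R) : gr 5 i f = f -> gr 5 0 (f ^+ 5) = f ^+ 5.
Proof.
move=> fi; have grX k : gr 5 (i * k) (f ^+ k) = f ^+ k.
  elim: k => [|k IH]; first by rewrite muln0 expr0 gr1.
  by rewrite mulnS exprS gr_mull // IH.
by rewrite -[RHS]grX; apply: gr_mod; rewrite modnMl.
Qed.

Lemma gr_disc i f : gr 5 i (D * f) = D * gr 5 i f.
Proof.
rewrite -[in LHS](add0n i) gr_mull // discE 2!grD grMn.
by rewrite !(gr_expr5 (gr_gr _ _ _)).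
Qed.

Lemma gr_dil0 (f : series R) : gr 5 0 (dil f) = dil f.
Proof.
rewrite -[RHS](congr1 (@dil R) (_ : gr 1 0 f = f)) ?(@gr_dil R 1 0) //.
by apply/funext => n; rewrite /gr !modn1.
Qed.

Lemma EG : E * G = 1. Proof. exact: euler_inv. Qed.

Lemma coef0M (f g : series R) : (f * g) 0%N = f 0%N * g 0%N.
Proof. by rewrite mulSE big_ord1. Qed.

Lemma coef0X (f : series R) k : (f ^+ k) 0%N = f 0%N ^+ k.
Proof.
elim: k => [|k IH]; first by rewrite !expr0 oneSE.
by rewrite !exprS coef0M IH.
Qed.

Lemma disc0 : D 0%N = 1.
Proof.
have y0 : y 0%N = 0 by [].
rewrite /disc !addSE oppSE !mulnSE !coef0M !coef0X y0 euler0.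
by rewrite expr0n !mul0r !mul0rn expr1n subr0 addr0.
Qed.

Lemma DW : D * W = 1. Proof. exact/mulSV/disc0. Qed.

(* As [4 * n = - n] modulo 5, this is the part with exponents -n mod 5. *)
Definition inv_part n : series R := gr 5 (4 * n) (G ^+ n).

Lemma discG n :
  D * G ^+ (n + 5) = G ^+ n - (y * G ^+ n.+1) *+ 5 + (y ^+ 2 * G ^+ n.+2) *+ 15.
Proof.
have EGX k m : E ^+ k * G ^+ (k + m) = G ^+ m.
  by rewrite exprD mulrA -exprMn EG expr1n mul1r.
rewrite -[in RHS](EGX 5%N n) -[in G ^+ n.+1](EGX 4%N) -[in G ^+ n.+2](EGX 3%N).
by rewrite addnC /disc; ring.
Qed.

Lemma disc_inj f g : D * f = g -> f = W * g.
Proof. by move=> <-; rewrite mulrA (mulrC W) DW mul1r. Qed.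

(** The component -n of [discG]: [D] is a series in q^5 and passes through, while y and y^2 raise
    degrees by 1 and 2, matching -(n+1) and -(n+2). *)
Lemma inv_part_rec n :
  inv_part (n + 5) =
    W * (inv_part n - (y * inv_part n.+1) *+ 5 + (y ^+ 2 * inv_part n.+2) *+ 15).
Proof.
apply: disc_inj; rewrite -gr_disc discG 2!grD grN !grMn.
have e1 : (4 * (n + 5) = (4 * n.+1).+1 %[mod 5])%N by lia.
have e2 : (4 * (n + 5) = (4 * n.+2).+2 %[mod 5])%N by lia.
have e3 : (4 * (n + 5) = 4 * n %[mod 5])%N by lia.
by rewrite (gr_mod _ e3) (gr_mod (y * _) e1) (gr_mod (_ ^+ 2 * _) e2) gr_y gr_y2.
Qed.

(** The formula [discG] at the negative indices -4 to -1, where negative powers of [G] are powers of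
    [E]; these start the recurrence. *)
Lemma discG1 : D * G = E ^+ 4 - (y * E ^+ 3) *+ 5 + (y ^+ 2 * E ^+ 2) *+ 15.
Proof. rewrite /disc; ring: EG. Qed.
Lemma discG2 : D * G ^+ 2 = E ^+ 3 - (y * E ^+ 2) *+ 5 + (y ^+ 2 * E) *+ 15.
Proof. rewrite /disc; ring: EG. Qed.
Lemma discG3 : D * G ^+ 3 = E ^+ 2 - (y * E) *+ 5 + (y ^+ 2) *+ 15.
Proof. rewrite /disc; ring: EG. Qed.
Lemma discG4 : D * G ^+ 4 = E - y *+ 5 + (y ^+ 2 * G) *+ 15.
Proof. rewrite /disc; ring: EG. Qed.

(** * Values of the parts u_n modulo 25 *)

Lemma inv_part1 : inv_part 1 = y ^+ 4 * W *+ 5.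
Proof.
rewrite /inv_part expr1; have -> : gr 5 (4 * 1) G = W * gr 5 4 (D * G).
  by apply: disc_inj; rewrite -gr_disc.
rewrite discG1 2!grD grN !grMn gr_y gr_y2 gr_euler2 gr_euler3 gr_euler4.
ring.
Qed.

Lemma inv_part2 : inv_part 2 = - (y ^+ 3 * W *+ 10).
Proof.
have e := mul25 char25_series (y ^+ 3).
have -> : inv_part 2 = W * gr 5 3 (D * G ^+ 2).
  by apply: disc_inj; rewrite -gr_disc.
rewrite discG2 2!grD grN !grMn gr_y gr_y2 gr_euler2 gr_euler3.
rewrite -[RHS]addr0 -(mul0r W) -e; ring.
Qed.

Lemma inv_part3 : inv_part 3 = y ^+ 2 * W *+ 9.
Proof.
have -> : inv_part 3 = W * gr 5 2 (D * G ^+ 3).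
  by apply: disc_inj; rewrite -gr_disc.
have y2 : gr 5 2 (y ^+ 2) = y ^+ 2 by rewrite -[y ^+ 2 in LHS]mulr1 gr_y2 gr1 mulr1.
by rewrite discG3 2!grD grN !grMn gr_y y2 gr_euler2; ring.
Qed.

Lemma inv_part4 : inv_part 4 = - (y * W *+ 4).
Proof.
have e := mul25 char25_series (y ^+ 6 * W ^+ 2 *+ 3).
have -> : inv_part 4 = W * gr 5 1 (D * G ^+ 4).
  by apply: disc_inj; rewrite -gr_disc.
rewrite discG4 2!grD grN !grMn gr_gr (@gr_mod R 5 1 6 (y ^+ 2 * G)) // gr_y2.
rewrite -[gr 5 4 G]/(inv_part 1) inv_part1 -[RHS]addr0 -e; ring.
Qed.

Lemma inv_part0 : inv_part 0 = 1. Proof. exact: gr1. Qed.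

(** In the lemmas below, [m] is 1/25 of the amount by which a coefficient produced by the recurrence
    is reduced. *)
Lemma mul_n25 (a : series R) m : a *+ (25 * m) = 0.
Proof. by rewrite mulrnA mul25 ?mul0rn //; apply: char25_series. Qed.

Lemma inv_part5 : inv_part 5 = W.
Proof.
rewrite (inv_part_rec 0) inv_part0 inv_part1 inv_part2.
rewrite -[RHS]subr0 -(mul_n25 (y ^+ 5 * W ^+ 2) 7); ring.
Qed.

Lemma inv_part6 : inv_part 6 = y ^+ 4 * W ^+ 2 *+ 15.
Proof.
rewrite (inv_part_rec 1) inv_part1 inv_part2 inv_part3.
rewrite -[RHS]addr0 -(mul_n25 (y ^+ 4 * W ^+ 2) 7); ring.
Qed.

Lemma inv_part7 : inv_part 7 = y ^+ 3 * W ^+ 2 *+ 10.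
Proof.
rewrite (inv_part_rec 2) inv_part2 inv_part3 inv_part4.
rewrite -[RHS]subr0 -(mul_n25 (y ^+ 3 * W ^+ 2) 5); ring.
Qed.

Lemma inv_part8 : inv_part 8 = - (y ^+ 2 * W ^+ 2 *+ 6).
Proof.
rewrite (inv_part_rec 3) inv_part3 inv_part4 inv_part5.
rewrite -[RHS]addr0 -(mul_n25 (y ^+ 2 * W ^+ 2) 2); ring.
Qed.

Lemma inv_part9 : inv_part 9 = - (y * W ^+ 2 *+ 9).
Proof.
rewrite (inv_part_rec 4) inv_part4 inv_part5 inv_part6.
rewrite -[RHS]addr0 -(mul_n25 (y ^+ 6 * W ^+ 3) 9); ring.
Qed.

Lemma inv_part10 : inv_part 10 = W ^+ 2.
Proof.
rewrite (inv_part_rec 5) inv_part5 inv_part6 inv_part7.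
rewrite -[RHS]addr0 -(mul_n25 (y ^+ 5 * W ^+ 3) 3); ring.
Qed.

(** The contributions 15, -50 and -90 add up to -125, so the coefficients vanish on the whole class
    -11 mod 5. *)
Lemma inv_part11 : inv_part 11 = 0.
Proof.
rewrite (inv_part_rec 6) inv_part6 inv_part7 inv_part8.
rewrite -[RHS]oppr0 -(mul_n25 (y ^+ 4 * W ^+ 3) 5); ring.
Qed.

Lemma inv_part12 : inv_part 12 = y ^+ 3 * W ^+ 3 *+ 5.
Proof.
rewrite (inv_part_rec 7) inv_part7 inv_part8 inv_part9.
rewrite -[RHS]subr0 -(mul_n25 (y ^+ 3 * W ^+ 3) 4); ring.
Qed.

Lemma inv_part13 : inv_part 13 = y ^+ 2 * W ^+ 3 *+ 4.
Proof.
rewrite (inv_part_rec 8) inv_part8 inv_part9 inv_part10.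
rewrite -[RHS]addr0 -(mul_n25 (y ^+ 2 * W ^+ 3) 2); ring.
Qed.

Lemma inv_part14 : inv_part 14 = - (y * W ^+ 3 *+ 14).
Proof. rewrite (inv_part_rec 9) inv_part9 inv_part10 inv_part11; ring. Qed.

(** Here the contributions are 5, -20 and -210, with sum -225. *)
Lemma inv_part17 : inv_part 17 = 0.
Proof.
rewrite (inv_part_rec 12) inv_part12 inv_part13 inv_part14.
rewrite -[RHS]oppr0 -(mul_n25 (y ^+ 3 * W ^+ 4) 9); ring.
Qed.

(** * Extraction of the exponents -k modulo 25 *)

Lemma inv_unique (A : comNzRingType) (a b c : A) : a * b = 1 -> a * c = 1 -> b = c.
Proof. by move=> ab ac; rewrite -[b]mulr1 -ac mulrCA mulrA ab mul1r. Qed.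

Lemma dilEG : dil E * dil G = 1.
Proof. by rewrite -rmorphM EG rmorph1. Qed.

Lemma inv25 : G ^+ 25 = dil G ^+ 5.
Proof.
apply: (@inv_unique _ (E ^+ 25)); first by rewrite -exprMn EG expr1n.
by rewrite euler25 -exprMn dilEG expr1n.
Qed.

Lemma inv_eq5 (a b c d : series R) :
  a * b = 1 -> c * d = 1 -> a *+ 5 = c *+ 5 -> b *+ 5 = d *+ 5.
Proof.
move=> ab cd ac; have -> : b *+ 5 = b * d * (c *+ 5) by ring: cd.
by rewrite -ac; ring: ab.
Qed.

Lemma inv5 : G ^+ 5 *+ 5 = dil G *+ 5.
Proof.
apply: (@inv_eq5 (E ^+ 5) _ (dil E)); last exact: euler5.
  by rewrite -exprMn EG expr1n.
exact: dilEG.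
Qed.

(** Modulo 5 the correction terms of [disc] drop out, leaving E^5, which is E(q^5). *)
Lemma disc_inv5 : W *+ 5 = dil G *+ 5.
Proof.
apply: (inv_eq5 DW dilEG); rewrite -euler5 -[RHS]addr0.
rewrite -(mul_n25 (y ^+ 2 * E ^+ 3 *+ 3 - y * E ^+ 4) 1) /disc; ring.
Qed.

(** Completing the exponent to 5(r+1) gives a power of G(q^5)^5, which is G(q^25) modulo 5, at the
    price of E(q^5)^(5-j). *)
Lemma dil_inv5 j r : (j <= 5)%N ->
  dil G ^+ (5 * r + j) *+ 5 = dil (dil G) ^+ r.+1 * dil (E ^+ (5 - j) *+ 5).
Proof.
move=> le_j5; have -> : dil G ^+ (5 * r + j) = dil (G ^+ 5) ^+ r.+1 * dil (E ^+ (5 - j)).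
  rewrite !rmorphXn /= -exprM (_ : 5 * r.+1 = 5 * r + j + (5 - j))%N; last by lia.
  by rewrite (exprD _ (5 * r + j)) -mulrA -exprMn [dil G * _]mulrC dilEG expr1n mulr1.
rewrite rmorphMn mulrnAr -!mulrnAl (@eq5X _ _ (dil (dil G))) //.
by rewrite -rmorphMn inv5 rmorphMn.
Qed.

Lemma gr25_y : gr 25 1 y = y. Proof. exact: gr_euler1. Qed.

Lemma gr25_yX e f i : gr 25 (e + i) (y ^+ e * f) = y ^+ e * gr 25 i f.
Proof.
elim: e i => [|e IH] i; first by rewrite !mul1r.
by rewrite exprS -mulrA addSn -[(e + i).+1]add1n gr_mull ?gr25_y // IH mulrA.
Qed.

Lemma gr25_dildil f i (r : nat) (h : series R) :
  gr 25 i (dil (dil f) ^+ r * h) = dil (dil f) ^+ r * gr 25 i h.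
Proof.
have d0 : gr 25 0 (dil (dil f)) = dil (dil f).
  by rewrite -[25%N]/(5 * 5)%N -[0%N]/(5 * 0)%N gr_dil gr_dil0.
elim: r => [|r IH]; first by rewrite !mul1r.
by rewrite exprS -mulrA -[i in LHS]add0n gr_mull // IH mulrA.
Qed.

Lemma coef_gr d i (f : series R) n : (n = i %[mod d])%N -> f n = gr d i f n.
Proof. by move=> ni; rewrite /gr ni eqxx. Qed.

Lemma gr_inv_part r k : gr 5 (4 * k) (G ^+ (25 * r + k)) = dil G ^+ (5 * r) * inv_part k.
Proof.
rewrite exprD exprM inv25 -exprM; elim: {r}(5 * r)%N => [|m IH].
  by rewrite !mul1r.
by rewrite exprS -mulrA -[(4 * k)%N in LHS]add0n gr_mull ?gr_dil0 // IH mulrA.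
Qed.

(** The 5 from [gr_euler3] or [gr_euler4] meets the outer 5. *)
Lemma gr_euler_mul5 j : (0 < j < 3)%N -> gr 5 (5 - j) (E ^+ (5 - j) *+ 5) = 0.
Proof.
case: j => [|[|[|]]] // _; rewrite grMn ?gr_euler4 ?gr_euler3 -mulrnA.
  exact: (mul_n25 _ 1).
exact: (mul_n25 _ 1).
Qed.

Lemma coef_inv_part0 r k n : (k <= 25)%N -> inv_part k = 0 ->
  (G ^+ (25 * r + k)) (25 * n + 25 - k)%N = 0.
Proof.
(* Since k is at most 25 the subtraction is not truncated, and 25n + 25 - k is 4k modulo 5. *)
move=> le_k pk; rewrite (@coef_gr 5 (4 * k)); last by lia.
by rewrite gr_inv_part pk mulr0 zeroSE.
Qed.

Lemma coef_inv_part r k n j e c : (0 < j < 3)%N -> (k + e = 5 * j)%N -> (k <= 25)%N ->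
    inv_part k = (y ^+ e * W ^+ j *+ 5) *+ c \/
      inv_part k = - ((y ^+ e * W ^+ j *+ 5) *+ c) ->
  (G ^+ (25 * r + k)) (25 * n + 25 - k)%N = 0.
Proof.
move=> j12 kej le_k pk; have grE0 := gr_euler_mul5 j12.
pose f : series R := dil G ^+ (5 * r) * (y ^+ e * W ^+ j *+ 5).
have f0 : f (25 * n + 25 - k)%N = 0.
  (* The factor 5 allows [W] to be replaced by G(q^5), merging the two powers. *)
  rewrite /f -mulrnAr (eq5X _ disc_inv5) mulrCA mulrnAr -exprD dil_inv5; last by lia.
  (* As k + e = 5j, this degree is 25 - k. Removing y^e and the series in q^25 leaves degree 5(5-j)
     of E(q^5)^(5-j), that is, degree 5-j of E^(5-j). *)
  rewrite (@coef_gr 25 (e + 5 * (5 - j))); last by lia.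
  by rewrite gr25_yX gr25_dildil (@gr_dil R 5) grE0 rmorph0 !mulr0 zeroSE.
rewrite (@coef_gr 5 (4 * k)); last by lia.
rewrite gr_inv_part; case: pk => ->.
  by rewrite mulrnAr -/f mulnSE f0 mul0rn.
by rewrite mulrN oppSE mulrnAr -/f mulnSE f0 mul0rn oppr0.
Qed.

Lemma colored_eq0 r k n : k \in [:: 1; 2; 6; 7; 11; 17]%N ->
  (p_colored (25 * r + k) (25 * n + 25 - k))%:R = 0 :> R.
Proof.
rewrite -colored_series !inE => /or4P[|||/or3P[]] /eqP->.
(* The last three arguments are j, e = 5j - k and the cofactor c, read off the value of
   [inv_part k]. *)
- by apply: (@coef_inv_part r 1 n 1 4 1) => //; left; rewrite inv_part1.
- by apply: (@coef_inv_part r 2 n 1 3 2) => //; right; rewrite inv_part2 -mulrnA.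
- by apply: (@coef_inv_part r 6 n 2 4 3) => //; left; rewrite inv_part6 -mulrnA.
- by apply: (@coef_inv_part r 7 n 2 3 2) => //; left; rewrite inv_part7 -mulrnA.
- exact: coef_inv_part0 inv_part11.
- exact: coef_inv_part0 inv_part17.
Qed.

End Congruences.

Local Close Scope ring_scope.

Theorem theorem1p1 (r k : nat) (hk : k \in [:: 1; 2; 6; 7; 11; 17]) (n : nat) :
  p_colored (25 * r + k) (25 * n + 25 - k) = 0 %[mod 25].
Proof.
have char25 : (25%:R = 0 :> 'Z_25)%R by apply/eqP.
by have /(congr1 val) := colored_eq0 char25 r n hk; rewrite /= val_Zp_nat.
Qed.
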